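(* Let $\Bbbk$ be a field and let $H$ be a $\Bbbk$-vector space that is a unital (not necessarily associative) algebra with product $\mu: H\otimes H\to H$ and unit $1:\Bbbk\to H$, and a counital (not necessarily coassociative) coalgebra with coproduct $\Delta: H\to H\otimes H$ and counit $\varepsilon: H\to\Bbbk$ that are algebra homomorphisms. Let $\beta,\gamma: H\otimes H\to H\otimes H$ be the right and left Galois maps, $\beta=(\mu\otimes H)\circ(H\otimes\Delta)$ and $\gamma=(H\otimes\mu)\circ(\Delta\otimes H)$. (1) $H$ is a Hopf quasigroup if and only if $\Delta$ is coassociative, $\beta$ has an inverse that is almost left $H$-linear, and $\gamma$ has an inverse that is almost right $H$-linear. (2) $H$ is a Hopf coquasigroup if and only if $\mu$ is associative, $\beta$ has an inverse that is almost right $H$-colinear, and $\gamma$ has an inverse that is almost left $H$-colinear.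
   Context: All tensor products are over the field $\Bbbk$; the identity map on a vector space $V$ is denoted by $V$; $\mu(g\otimes h)$ is written $gh$; $\Delta(h)=h_{(1)}\otimes h_{(2)}$ (Sweedler notation; summation understood). Algebra homomorphisms are unital, and $H\otimes H$ has the componentwise product. Let $H$ be as in the first sentence of the claim. Hopf quasigroup: $H$ is a Hopf quasigroup if $\Delta$ is coassociative and there exists a linear map $S:H\to H$ with $\mu\circ(H\otimes\mu)\circ(S\otimes H\otimes H)\circ(\Delta\otimes H)=\varepsilon\otimes H=\mu\circ(H\otimes\mu)\circ(H\otimes S\otimes H)\circ(\Delta\otimes H)$ and $\mu\circ(\mu\otimes H)\circ(H\otimes H\otimes S)\circ(H\otimes\Delta)=H\otimes\varepsilon=\mu\circ(\mu\otimes H)\circ(H\otimes S\otimes H)\circ(H\otimes\Delta)$. Hopf coquasigroup: $H$ is a Hopf coquasigroup if $\mu$ is associative and there exists a linear map $S:H\to H$ with $(\mu\otimes H)\circ(S\otimes H\otimes H)\circ(H\otimes\Delta)\circ\Delta=1\otimes H=(\mu\otimes H)\circ(H\otimes S\otimes H)\circ(H\otimes\Delta)\circ\Delta$ and $(H\otimes\mu)\circ(H\otimes H\otimes S)\circ(\Delta\otimes H)\circ\Delta=H\otimes 1=(H\otimes\mu)\circ(H\otimes S\otimes H)\circ(\Delta\otimes H)\circ\Delta$. Let $\phi:H\otimes H\to H\otimes H$ be a $\Bbbk$-linear map. - $\phi$ is almost left $H$-linear if $\phi(g\otimes h)=(g\otimes 1)\phi(1\otimes h)$ for all $g,h\in H$.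 - $\phi$ is almost right $H$-linear if $\phi(g\otimes h)=\phi(g\otimes 1)(1\otimes h)$ for all $g,h\in H$. - $\phi$ is almost left $H$-colinear if $\phi=(H\otimes\varepsilon\otimes H)\circ(H\otimes\phi)\circ(\Delta\otimes H)$, i.e. $\phi(g\otimes h)=g_{(1)}\otimes(\varepsilon\otimes H)(\phi(g_{(2)}\otimes h))$. - $\phi$ is almost right $H$-colinear if $\phi=(H\otimes\varepsilon\otimes H)\circ(\phi\otimes H)\circ(H\otimes\Delta)$, i.e. $\phi(g\otimes h)=(H\otimes\varepsilon)(\phi(g\otimes h_{(1)}))\otimes h_{(2)}$. *)

(* Defs.v *)
From HB Require Import structures.
From mathcomp Require Import all_boot all_order all_algebra.
From mathcomp Require Import boolp.

Set Implicit Arguments.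
Unset Strict Implicit.
Unset Printing Implicit Defensive.

Import GRing.Theory.
Local Open Scope ring_scope.
Local Open Scope quotient_scope.

Reserved Notation "u \ox v" (at level 40, left associativity).
Reserved Notation "f \oxm g" (at level 40, left associativity).

(* MathComp has no tensor product of (possibly infinite-dimensional) modules.
   V \ox W is the quotient of the free monoid on V * W (finite formal sums of
   pairs, concatenation being the sum) by the congruence generated by
   commutativity and the bilinearity relations.  Additive inverses come for
   free: -(v, w) is (- v, w).  [tlift_tens] and [tens_ext] below give the
   universal property. *)
Section TensorType.
Context {k : fieldType} (V W : lmodType k).

Inductive teq : seq (V * W) -> seq (V * W) -> Prop :=
| teq_refl s : teq s s
| teq_sym s t : teq s t -> teq t s
| teq_trans s t u : teq s t -> teq t u -> teq s u
| teq_cat s s' t t' : teq s s' -> teq t t' -> teq (s ++ t) (s' ++ t')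
| teq_catC s t : teq (s ++ t) (t ++ s)
| teq_0l w : teq [:: (0, w)] [::]
| teq_Dl v v' w : teq [:: (v + v', w)] [:: (v, w); (v', w)]
| teq_Dr v w w' : teq [:: (v, w + w')] [:: (v, w); (v, w')]
| teq_Z a v w : teq [:: (a *: v, w)] [:: (v, a *: w)].

Definition teqb (s t : seq (V * W)) : bool := `[< teq s t >].

Fact teqb_refl : reflexive teqb.
Proof. by move=> s; apply/asboolP; exact: teq_refl. Qed.

Fact teqb_sym : symmetric teqb.
Proof. by move=> s t; apply/asboolP/asboolP; exact: teq_sym. Qed.

Fact teqb_trans : transitive teqb.
Proof.
by move=> t s u /asboolP st /asboolP tu; apply/asboolP; exact: teq_trans tu.
Qed.

Canonical teqb_equiv := EquivRel teqb teqb_refl teqb_sym teqb_trans.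

Definition tensor := {eq_quot teqb}.

HB.instance Definition _ := Choice.on tensor.
HB.instance Definition _ := Quotient.on tensor.

Fact teqP s t : reflect (\pi_tensor s = \pi_tensor t) `[< teq s t >].
Proof. exact: (@eqquotP _ teqb_equiv). Qed.

Fact teq_pi s t : teq s t -> \pi_tensor s = \pi_tensor t.
Proof. by move=> st; apply/teqP/asboolP. Qed.

Fact teq_repr s : teq (repr (\pi_tensor s)) s.
Proof. by apply/asboolP/teqP; rewrite reprK. Qed.

Definition fscale (a : k) (s : seq (V * W)) := [seq (a *: p.1, p.2) | p <- s].

Let teq_fscale a s t : teq s t -> teq (fscale a s) (fscale a t).
Proof.
elim=> {s t} [s|s t _|s t u _ st _ tu|s s' t t' _ ss' _ tt'|s t|w|v v' w|v w w'|b v w].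
- exact: teq_refl.
- exact: teq_sym.
- exact: teq_trans tu.
- by rewrite /fscale !map_cat; exact: teq_cat.
- by rewrite /fscale !map_cat; exact: teq_catC.
- by rewrite /fscale /= scaler0; exact: teq_0l.
- by rewrite /fscale /= scalerDr; exact: teq_Dl.
- exact: teq_Dr.
- by rewrite /fscale /= scalerA mulrC -scalerA; exact: teq_Z.
Qed.

Definition tensor_add (x y : tensor) : tensor := \pi_tensor (repr x ++ repr y).
Definition tensor_scale (a : k) (x : tensor) : tensor := \pi_tensor (fscale a (repr x)).

Let pi_add s t : tensor_add (\pi_tensor s) (\pi_tensor t) = \pi_tensor (s ++ t).
Proof. by apply: teq_pi; apply: teq_cat; exact: teq_repr. Qed.

Let pi_scale a s : tensor_scale a (\pi_tensor s) = \pi_tensor (fscale a s).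
Proof. by apply: teq_pi; apply: teq_fscale; exact: teq_repr. Qed.

Let taddA : associative tensor_add.
Proof.
move=> x y z; elim/quotW: x => x; elim/quotW: y => y; elim/quotW: z => z.
by rewrite (pi_add y z) (pi_add x) (pi_add x y) (pi_add (x ++ y)) catA.
Qed.

Let taddC : commutative tensor_add.
Proof.
move=> x y; elim/quotW: x => x; elim/quotW: y => y.
by rewrite (pi_add x) (pi_add y); apply: teq_pi; exact: teq_catC.
Qed.

Let tadd0 : left_id (\pi_tensor [::]) tensor_add.
Proof. by move=> x; elim/quotW: x => x; rewrite pi_add. Qed.

Let taddN : left_inverse (\pi_tensor [::]) (tensor_scale (-1)) tensor_add.
Proof.
move=> x; elim/quotW: x => x; rewrite (pi_scale _ x) pi_add; apply: teq_pi.
elim: x => [|[v w] x IH]; first exact: teq_refl.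
have vw0 : teq [:: (-1 *: v, w); (v, w)] [::].
  apply: teq_trans (teq_sym (teq_Dl _ _ _)) _.
  by rewrite scaleN1r addNr; exact: teq_0l.
apply: (@teq_trans _ ([:: (-1 *: v, w)] ++ (((v, w) :: x) ++ fscale (-1) x))).
  exact: (teq_cat (teq_refl [:: _]) (teq_catC (fscale (-1) x) ((v, w) :: x))).
apply: (@teq_trans _ ([::] ++ (fscale (-1) x ++ x))) IH.
exact: (teq_cat vw0 (teq_catC x (fscale (-1) x))).
Qed.

HB.instance Definition _ := GRing.isZmodule.Build tensor taddA taddC tadd0 taddN.

Definition tens (v : V) (w : W) : tensor := \pi_tensor [:: (v, w)].

Let pi_sum s : \pi_tensor s = \sum_(p <- s) tens p.1 p.2.
Proof.
elim: s => [|[v w] s IH]; first by rewrite big_nil.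
by rewrite big_cons -IH -cat1s -pi_add.
Qed.

Let tensDl v v' w : tens (v + v') w = tens v w + tens v' w.
Proof. by rewrite [RHS]pi_add; apply: teq_pi; exact: teq_Dl. Qed.

Let tscale_sum a s : tensor_scale a (\pi_tensor s) = \sum_(p <- s) tens (a *: p.1) p.2.
Proof. by rewrite pi_scale pi_sum big_map. Qed.

Let tscaleA a b x : tensor_scale a (tensor_scale b x) = tensor_scale (a * b) x.
Proof.
elim/quotW: x => x; rewrite (pi_scale b) !pi_scale /fscale -map_comp; congr \pi_tensor.
by apply: eq_map => p /=; rewrite scalerA.
Qed.

Let tscale1 : left_id 1 tensor_scale.
Proof.
move=> x; elim/quotW: x => x; rewrite tscale_sum pi_sum.
by apply: eq_bigr => p _; rewrite scale1r.
Qed.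

Let tscaleDr : right_distributive tensor_scale +%R.
Proof.
move=> a x y; elim/quotW: x => x; elim/quotW: y => y.
have -> : \pi_tensor x + \pi_tensor y = \pi_tensor (x ++ y) by exact: pi_add.
by rewrite !tscale_sum big_cat.
Qed.

Let tscaleDl x : {morph tensor_scale^~ x : a b / a + b}.
Proof.
move=> a b; elim/quotW: x => x; rewrite !tscale_sum -big_split.
by apply: eq_bigr => p _; rewrite scalerDl tensDl.
Qed.

HB.instance Definition _ :=
  GRing.Zmodule_isLmodule.Build k tensor tscaleA tscale1 tscaleDr tscaleDl.

Fact tens_is_bilinear : bilinear_for *:%R *:%R tens.
Proof.
split=> [w a v v'|v a w w']; first by rewrite tensDl; congr (_ + _); rewrite [RHS]pi_scale.
have -> : tens v (a *: w + w') = tens v (a *: w) + tens v w'.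
  by rewrite [RHS]pi_add; apply: teq_pi; exact: teq_Dr.
congr (_ + _); rewrite [RHS]pi_scale.
by apply: teq_pi; apply: teq_sym; exact: teq_Z.
Qed.

HB.instance Definition _ :=
  bilinear_isBilinear.Build k V W tensor *:%R *:%R tens tens_is_bilinear.

Lemma tensorE (x : tensor) : x = \sum_(p <- repr x) tens p.1 p.2.
Proof. by rewrite -pi_sum reprK. Qed.

Section Lift.
Variable U : lmodType k.

Definition tlift (f : V -> W -> U) : tensor -> U :=
  locked (fun x => \sum_(p <- repr x) f p.1 p.2).

Variable f : {bilinear V -> W -> U}.

Let teq_lift s t : teq s t -> \sum_(p <- s) f p.1 p.2 = \sum_(p <- t) f p.1 p.2.
Proof.
elim=> {s t} [//|s t _ -> //|s t u _ -> //|s s' t t' _ ss' _ tt'|s t|w|v v' w|v w w'|a v w].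
- by rewrite !big_cat /= ss' tt'.
- by rewrite !big_cat /= addrC.
- by rewrite big_seq1 big_nil /= linear0l.
- by rewrite !big_cons !big_nil !addr0 /= linearDl.
- by rewrite !big_cons !big_nil !addr0 /= linearDr.
- by rewrite !big_seq1 /= linearZr_LR linearZl_LR.
Qed.

Let tlift_pi s : tlift f (\pi_tensor s) = \sum_(p <- s) f p.1 p.2.
Proof. by rewrite /tlift -lock; apply: teq_lift; exact: teq_repr. Qed.

Fact tlift_is_linear : linear (tlift f).
Proof.
move=> a x y; elim/quotW: x => x; elim/quotW: y => y.
have -> : a *: \pi_tensor x = \pi_tensor (fscale a x) by exact: pi_scale.
have -> : \pi_tensor (fscale a x) + \pi_tensor y = \pi_tensor (fscale a x ++ y) by exact: pi_add.
rewrite !tlift_pi big_cat big_map scaler_sumr; congr (_ + _).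
by apply: eq_bigr => p _ /=; rewrite linearZl_LR.
Qed.

HB.instance Definition _ :=
  GRing.isLinear.Build k tensor U *:%R (tlift f) tlift_is_linear.

Lemma tlift_tens v w : tlift f (tens v w) = f v w.
Proof. by rewrite tlift_pi big_seq1. Qed.

End Lift.

Lemma tens_ext (U : lmodType k) (f g : {linear tensor -> U}) :
  (forall v w, f (tens v w) = g (tens v w)) -> f =1 g.
Proof.
by move=> fg x; rewrite (tensorE x) !linear_sum; apply: eq_bigr => p _.
Qed.

End TensorType.

Notation "V \ox W" := (tensor V%type W%type) : type_scope.
Notation "v \ox w" := (tens v w) : ring_scope.

Section TensorMaps.
Context {k : fieldType}.

Section Map.
Context {V W V' W' : lmodType k}.
Variables (f : {linear V -> V'}) (g : {linear W -> W'}).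

Definition tmap2 (v : V) (w : W) : V' \ox W' := f v \ox g w.
Fact tmap2_is_bilinear : bilinear_for *:%R *:%R tmap2.
Proof.
by split=> [w a v v'|v a w w']; rewrite /tmap2 linearP ?linearPl ?linearPr.
Qed.
HB.instance Definition _ :=
  bilinear_isBilinear.Build k V W (V' \ox W')%type *:%R *:%R tmap2 tmap2_is_bilinear.

Definition tmap : V \ox W -> V' \ox W' := tlift tmap2.
HB.instance Definition _ := GRing.Linear.on tmap.

Lemma tmapE v w : tmap (v \ox w) = f v \ox g w.
Proof. exact: tlift_tens. Qed.
End Map.

Section Swap.
Context {V W : lmodType k}.

Definition tswap2 (v : V) (w : W) : W \ox V := w \ox v.
Fact tswap2_is_bilinear : bilinear_for *:%R *:%R tswap2.
Proof. by split=> [w a v v'|v a w w']; rewrite /tswap2 ?linearPl ?linearPr. Qed.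
HB.instance Definition _ :=
  bilinear_isBilinear.Build k V W (W \ox V)%type *:%R *:%R tswap2 tswap2_is_bilinear.

Definition tswap : V \ox W -> W \ox V := tlift tswap2.
HB.instance Definition _ := GRing.Linear.on tswap.

Lemma tswapE v w : tswap (v \ox w) = w \ox v.
Proof. exact: tlift_tens. Qed.
End Swap.

Section Unitors.
Context {V : lmodType k}.

Definition tunitl2 (a : k^o) (v : V) : V := a *: v.
Fact tunitl2_is_bilinear : bilinear_for *:%R *:%R tunitl2.
Proof.
split=> [v a b c|b a v w]; first by rewrite /tunitl2 /= scalerDl scalerA.
by rewrite /tunitl2 scalerDr scalerA (mulrC (b : k)) -scalerA.
Qed.
HB.instance Definition _ :=
  bilinear_isBilinear.Build k k^o V V *:%R *:%R tunitl2 tunitl2_is_bilinear.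

Definition tunitl : k^o \ox V -> V := tlift tunitl2.
HB.instance Definition _ := GRing.Linear.on tunitl.

Lemma tunitlE (a : k^o) v : tunitl (a \ox v) = a *: v.
Proof. exact: tlift_tens. Qed.

Definition tunitr : V \ox k^o -> V := tunitl \o tswap.
HB.instance Definition _ := GRing.Linear.on tunitr.

Lemma tunitrE v (a : k^o) : tunitr (v \ox a) = a *: v.
Proof. by rewrite /tunitr /= tswapE tunitlE. Qed.

Definition tunitl_inv (v : V) : k^o \ox V := (1 : k^o) \ox v.
Fact tunitl_inv_is_linear : linear tunitl_inv.
Proof. by move=> a v w; rewrite /tunitl_inv linearPr. Qed.
HB.instance Definition _ :=
  GRing.isLinear.Build k V (k^o \ox V)%type *:%R tunitl_inv tunitl_inv_is_linear.

Definition tunitr_inv (v : V) : V \ox k^o := v \ox (1 : k^o).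
Fact tunitr_inv_is_linear : linear tunitr_inv.
Proof. by move=> a v w; rewrite /tunitr_inv linearPl. Qed.
HB.instance Definition _ :=
  GRing.isLinear.Build k V (V \ox k^o)%type *:%R tunitr_inv tunitr_inv_is_linear.
End Unitors.

Section Assoc.
Context {U V W : lmodType k}.

Section Curry.
Variable w : W.
Definition tassoc3 (u : U) (v : V) : U \ox (V \ox W) := u \ox (v \ox w).
Fact tassoc3_is_bilinear : bilinear_for *:%R *:%R tassoc3.
Proof. by split=> [v a u u'|u a v v']; rewrite /tassoc3 ?linearPl ?linearPr. Qed.
HB.instance Definition _ :=
  bilinear_isBilinear.Build k U V (U \ox (V \ox W))%type *:%R *:%R tassoc3 tassoc3_is_bilinear.
Definition tassoc_at : U \ox V -> U \ox (V \ox W) := tlift tassoc3.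
HB.instance Definition _ := GRing.Linear.on tassoc_at.
Lemma tassoc_atE u v : tassoc_at (u \ox v) = u \ox (v \ox w).
Proof. exact: tlift_tens. Qed.
End Curry.

Definition tassoc2 (x : U \ox V) (w : W) : U \ox (V \ox W) := tassoc_at w x.
Fact tassoc2_is_bilinear : bilinear_for *:%R *:%R tassoc2.
Proof.
split=> [w a x y|x a w w']; rewrite /tassoc2 ?linearP // (tensorE x).
rewrite !linear_sum /= scaler_sumr -big_split; apply: eq_bigr => p _ /=.
by rewrite !tassoc_atE !linearPr.
Qed.
HB.instance Definition _ :=
  bilinear_isBilinear.Build k (U \ox V)%type W (U \ox (V \ox W))%type *:%R *:%R
    tassoc2 tassoc2_is_bilinear.

Definition tassoc : (U \ox V) \ox W -> U \ox (V \ox W) := tlift tassoc2.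
HB.instance Definition _ := GRing.Linear.on tassoc.

Lemma tassocE u v w : tassoc ((u \ox v) \ox w) = u \ox (v \ox w).
Proof. by rewrite /tassoc tlift_tens; exact: tassoc_atE. Qed.
End Assoc.

Section AssocInv.
Context {U V W : lmodType k}.

(* u (v w) -> u (w v) -> (w v) u -> w (v u) -> w (u v) -> (u v) w *)
Definition tassoc_inv : U \ox (V \ox W) -> (U \ox V) \ox W :=
  tswap \o tmap idfun tswap \o tassoc \o tswap \o tmap idfun tswap.
HB.instance Definition _ := GRing.Linear.on tassoc_inv.

Lemma tassoc_invE u v w : tassoc_inv (u \ox (v \ox w)) = (u \ox v) \ox w.
Proof. by rewrite /tassoc_inv /= tmapE /= !tswapE tassocE tmapE /= !tswapE. Qed.
End AssocInv.

Section AssocK.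
Context {U V W : lmodType k}.

Lemma tassocK : cancel (@tassoc U V W) tassoc_inv.
Proof.
apply: (@tens_ext _ _ _ _ (tassoc_inv \o tassoc) idfun) => y w /=.
rewrite (tensorE y) linear_sumlz !linear_sum; apply: eq_bigr => -[u v] _ /=.
by rewrite tassocE tassoc_invE.
Qed.

Lemma tassoc_invK : cancel (@tassoc_inv U V W) tassoc.
Proof.
apply: (@tens_ext _ _ _ _ (tassoc \o tassoc_inv) idfun) => u y /=.
rewrite (tensorE y) linear_sumr !linear_sum; apply: eq_bigr => -[v w] _ /=.
by rewrite tassoc_invE tassocE.
Qed.
End AssocK.

Section Interchange.
Context {U V W X : lmodType k}.

Definition tinterchange : (U \ox V) \ox (W \ox X) -> (U \ox W) \ox (V \ox X) :=
  tassoc_inv \o tmap idfun (tassoc \o tmap tswap idfun \o tassoc_inv) \o tassoc.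
HB.instance Definition _ := GRing.Linear.on tinterchange.

Lemma tinterchangeE u v w x :
  tinterchange ((u \ox v) \ox (w \ox x)) = (u \ox w) \ox (v \ox x).
Proof.
by rewrite /tinterchange /= tassocE tmapE /= tassoc_invE tmapE /= tswapE
           tassocE tassoc_invE.
Qed.
End Interchange.
End TensorMaps.

Notation "f \oxm g" := (tmap f g) : ring_scope.


Section Algebras.
Context {k : fieldType}.

(* Associativity is not required. *)
Record unital_algebra (A : lmodType k) := UnitalAlgebra {
  amul : {linear (A \ox A)%type -> A};
  aunit : {linear k^o -> A};
  amul1l : forall a, amul (aunit 1 \ox a) = a;
  amul1r : forall a, amul (a \ox aunit 1) = a
}.

(* Coassociativity is not required. *)
Record counital_coalgebra (C : lmodType k) := CounitalCoalgebra {
  comul : {linear C -> (C \ox C)%type};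
  counit : {linear C -> k^o};
  comul1l : forall c, tunitl ((counit \oxm idfun) (comul c)) = c;
  comul1r : forall c, tunitr ((idfun \oxm counit) (comul c)) = c
}.

Definition algebra_hom (A B : lmodType k) (mA : unital_algebra A)
    (mB : unital_algebra B) (f : {linear A -> B}) : Prop :=
  (forall a b, f (amul mA (a \ox b)) = amul mB (f a \ox f b)) /\
  f (aunit mA 1) = aunit mB 1.

Section Base.
Fact base_amul1l (a : k^o) : tunitl ((idfun (1 : k^o) : k^o) \ox a) = a.
Proof. by rewrite tunitlE scale1r. Qed.

Fact base_amul1r (a : k^o) : tunitl (a \ox (idfun (1 : k^o) : k^o)) = a.
Proof. by rewrite tunitlE; exact: mulr1. Qed.

Definition base_algebra : unital_algebra k^o :=
  @UnitalAlgebra k^o tunitl idfun base_amul1l base_amul1r.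
End Base.

Section TensorAlgebra.
Context {A B : lmodType k}.
Variables (mA : unital_algebra A) (mB : unital_algebra B).

Definition tensor_amul : (A \ox B) \ox (A \ox B) -> A \ox B :=
  (amul mA \oxm amul mB) \o tinterchange.
HB.instance Definition _ := GRing.Linear.on tensor_amul.

Definition tensor_aunit : k^o -> A \ox B :=
  (aunit mA \oxm aunit mB) \o tunitl_inv.
HB.instance Definition _ := GRing.Linear.on tensor_aunit.

Lemma tensor_amulE a b a' b' :
  tensor_amul ((a \ox b) \ox (a' \ox b')) =
  amul mA (a \ox a') \ox amul mB (b \ox b').
Proof. by rewrite /tensor_amul /= tinterchangeE tmapE. Qed.

Lemma tensor_aunitE : tensor_aunit 1 = aunit mA 1 \ox aunit mB 1.
Proof. by rewrite /tensor_aunit /= /tunitl_inv tmapE. Qed.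

Fact tensor_amul1l x : tensor_amul (tensor_aunit 1 \ox x) = x.
Proof.
rewrite tensor_aunitE (tensorE x) linear_sumr linear_sum.
by apply: eq_bigr => p _ /=; rewrite tensor_amulE !amul1l.
Qed.

Fact tensor_amul1r x : tensor_amul (x \ox tensor_aunit 1) = x.
Proof.
rewrite tensor_aunitE (tensorE x) linear_sumlz linear_sum.
by apply: eq_bigr => p _ /=; rewrite tensor_amulE !amul1r.
Qed.

Definition tensor_algebra : unital_algebra (A \ox B)%type :=
  @UnitalAlgebra (A \ox B)%type tensor_amul tensor_aunit tensor_amul1l tensor_amul1r.
End TensorAlgebra.

(* Neither associativity nor coassociativity is required. *)
Record nonassoc_bialgebra (H : lmodType k) := NonassocBialgebra {
  algebra_of : unital_algebra H;
  coalgebra_of : counital_coalgebra H;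
  comul_hom : algebra_hom algebra_of (tensor_algebra algebra_of algebra_of)
                (comul coalgebra_of);
  counit_hom : algebra_hom algebra_of base_algebra (counit coalgebra_of)
}.
End Algebras.

(* The identity of a space is written [idfun] and [f \oxm g] is the tensor
   product of the linear maps f and g.  The associativity isomorphisms
   [tassoc], [tassoc_inv] and the unit isomorphisms [tunitl], [tunitr] and
   their inverses, usually left implicit, are inserted explicitly. *)
Section HopfQuasigroups.
Context {k : fieldType} {H : lmodType k}.
Variable B : nonassoc_bialgebra H.

Local Notation mu := (amul (algebra_of B)).
Local Notation eta := (aunit (algebra_of B)).
Local Notation Delta := (comul (coalgebra_of B)).
Local Notation eps := (counit (coalgebra_of B)).
Local Notation I := (@idfun H).
Local Notation I2 := (@idfun (H \ox H)%type).
Local Notation "x ** y" := (amul (tensor_algebra (algebra_of B) (algebra_of B)) (x \ox y))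
  (at level 39, left associativity).

Definition associative_mul : Prop :=
  mu \o (mu \oxm I) =1 mu \o (I \oxm mu) \o tassoc.

Definition coassociative_comul : Prop :=
  tassoc \o (Delta \oxm I) \o Delta =1 (I \oxm Delta) \o Delta.

Definition hopf_quasigroup : Prop :=
  coassociative_comul /\
  exists S : {linear H -> H},
  [/\ mu \o (I \oxm mu) \o (S \oxm I2) \o tassoc \o (Delta \oxm I)
        =1 tunitl \o (eps \oxm I),
      mu \o (I \oxm mu) \o (I \oxm (S \oxm I)) \o tassoc \o (Delta \oxm I)
        =1 tunitl \o (eps \oxm I),
      mu \o (mu \oxm I) \o (I2 \oxm S) \o tassoc_inv \o (I \oxm Delta)
        =1 tunitr \o (I \oxm eps) &
      mu \o (mu \oxm I) \o ((I \oxm S) \oxm I) \o tassoc_inv \o (I \oxm Delta)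
        =1 tunitr \o (I \oxm eps)].

Definition hopf_coquasigroup : Prop :=
  associative_mul /\
  exists S : {linear H -> H},
  [/\ (mu \oxm I) \o tassoc_inv \o (S \oxm I2) \o (I \oxm Delta) \o Delta
        =1 (eta \oxm I) \o tunitl_inv,
      (mu \oxm I) \o ((I \oxm S) \oxm I) \o tassoc_inv \o (I \oxm Delta) \o Delta
        =1 (eta \oxm I) \o tunitl_inv,
      (I \oxm mu) \o tassoc \o (I2 \oxm S) \o (Delta \oxm I) \o Delta
        =1 (I \oxm eta) \o tunitr_inv &
      (I \oxm mu) \o (I \oxm (S \oxm I)) \o tassoc \o (Delta \oxm I) \o Delta
        =1 (I \oxm eta) \o tunitr_inv].

Definition right_galois : H \ox H -> H \ox H :=
  (mu \oxm I) \o tassoc_inv \o (I \oxm Delta).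
HB.instance Definition _ := GRing.Linear.on right_galois.

Definition left_galois : H \ox H -> H \ox H :=
  (I \oxm mu) \o tassoc \o (Delta \oxm I).
HB.instance Definition _ := GRing.Linear.on left_galois.

Section Almost.
Variable phi : {linear (H \ox H)%type -> (H \ox H)%type}.

Definition almost_left_linear : Prop :=
  forall g h : H, phi (g \ox h) = (g \ox eta 1) ** phi (eta 1 \ox h).

Definition almost_right_linear : Prop :=
  forall g h : H, phi (g \ox h) = phi (g \ox eta 1) ** (eta 1 \ox h).

Definition almost_left_colinear : Prop :=
  phi =1 (I \oxm tunitl) \o (I \oxm (eps \oxm I)) \o (I \oxm phi)
           \o tassoc \o (Delta \oxm I).

Definition almost_right_colinear : Prop :=
  phi =1 (tunitr \oxm I) \o ((I \oxm eps) \oxm I) \o (phi \oxm I)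
           \o tassoc_inv \o (I \oxm Delta).
End Almost.

(* The inverse, if any, is unique. *)
Definition has_inverse_that_is (f : H \ox H -> H \ox H)
    (P : {linear (H \ox H)%type -> (H \ox H)%type} -> Prop) : Prop :=
  exists phi : {linear (H \ox H)%type -> (H \ox H)%type},
    [/\ cancel f phi, cancel phi f & P phi].
End HopfQuasigroups.

(* Main.v *)
(** With [S] a linear endomorphism of H put [rtwist S (g ⊗ h) = g S(h1) ⊗ h2] and
    [ltwist S (g ⊗ h) = g1 ⊗ S(g2) h].  These are exactly the endomorphisms of
    [H ⊗ H] that are almost left linear and almost right colinear (resp. almost
    right linear and almost left colinear); [S] is recovered as
    [(H ⊗ ε) (phi (1 ⊗ h))].  If Δ is coassociative, the Galois maps and the twists
    are colinear in the strong sense [(H ⊗ Δ) f = (f ⊗ H) (H ⊗ Δ)], which passes to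
    inverses and makes [f = id] equivalent to [(H ⊗ ε) f = H ⊗ ε]; applied to the
    composites of the Galois map and the twist this is the Hopf quasigroup axiom.
    Dually, if μ is associative, all these maps are linear, and a linear map is the
    identity as soon as it fixes every [1 ⊗ h], which is the Hopf coquasigroup axiom.
    The left and right antipodes so obtained agree: evaluating [T(h1)(h2 S(h3))] in
    two ways gives [S = T] in the coassociative case, and [(S(h1) h2) T(h3)] does so,
    with the triple coproduct read as [(Δ ⊗ H) Δ], in the associative case. *)
Require Import Defs.
From HB Require Import structures.
From mathcomp Require Import all_boot all_order all_algebra.

Set Implicit Arguments.
Unset Strict Implicit.
Unset Printing Implicit Defensive.

Import GRing.Theory.
Local Open Scope ring_scope.

(* Reduces a goal whose two sides are linear in [x] to pure tensors. *)
Ltac expand_tensor x :=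
  rewrite (tensorE x) !(linear_sumlz, linear_sumr, linear_sum) /=;
  apply: eq_bigr => -[? ?] _ /=.

Section Galois.
Context {k : fieldType} {H : lmodType k} {B : nonassoc_bialgebra H}.

Local Notation mu := (amul (algebra_of B)).
Local Notation eta := (aunit (algebra_of B)).
Local Notation Delta := (comul (coalgebra_of B)).
Local Notation eps := (counit (coalgebra_of B)).
Local Notation I := (@idfun H).
Local Notation I2 := (@idfun (H \ox H)%type).
Local Notation "x ** y" := (amul (tensor_algebra (algebra_of B) (algebra_of B)) (x \ox y))
  (at level 39, left associativity).
Local Notation counitr := (tunitr \o (I \oxm eps)).

(** * The right Galois map *)

(** Multiplication on the first leg, a module action once [mu] is associative ([actlA]). The second
    leg is an arbitrary [W] because the colinearity proofs take [W := H \ox H]. *)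
Definition actl {W : lmodType k} : H \ox (H \ox W) -> H \ox W :=
  (mu \oxm idfun) \o tassoc_inv.
HB.instance Definition _ W := GRing.Linear.on (@actl W).

Lemma actlE (W : lmodType k) g a (b : W) : actl (g \ox (a \ox b)) = mu (g \ox a) \ox b.
Proof. by rewrite /actl /= tassoc_invE tmapE. Qed.

Lemma actl_nat (W W' : lmodType k) (f : {linear W -> W'}) g x :
  (I \oxm f) (actl (g \ox x)) = actl (g \ox (I \oxm f) x).
Proof. by expand_tensor x; rewrite actlE !tmapE actlE. Qed.

Lemma actl_tmapl (S : {linear H -> H}) g x :
  actl (g \ox (S \oxm I) x) = (mu \oxm I) (((I \oxm S) \oxm I) (tassoc_inv (g \ox x))).
Proof.
by expand_tensor x; rewrite tassoc_invE !tmapE actlE /= tmapE.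
Qed.

Lemma actl_tassoc g (x : H \ox H) (b : H) :
  actl (g \ox tassoc (x \ox b)) = tassoc (actl (g \ox x) \ox b).
Proof. by expand_tensor x; rewrite tassocE !actlE tassocE. Qed.

Lemma actl_mul g x : (g \ox eta 1) ** x = actl (g \ox x).
Proof. by expand_tensor x; rewrite tensor_amulE actlE amul1l. Qed.

Lemma actl1 x : actl (eta 1 \ox x) = x :> (H \ox H).
Proof. rewrite -actl_mul -tensor_aunitE; exact: tensor_amul1l. Qed.

Lemma amulA : associative_mul B -> forall a b c,
  mu (mu (a \ox b) \ox c) = mu (a \ox mu (b \ox c)).
Proof. by move=> A a b c; have /= := A ((a \ox b) \ox c); rewrite tassocE !tmapE. Qed.

Lemma actlA : associative_mul B -> forall g g' (x : H \ox H),
  actl (mu (g \ox g') \ox x) = actl (g \ox actl (g' \ox x)).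
Proof.
by move=> A g g' x; expand_tensor x; rewrite !actlE amulA.
Qed.

Lemma counitr_actl g x : counitr (actl (g \ox x)) = mu (g \ox counitr x).
Proof.
rewrite /=; expand_tensor x.
by rewrite actlE !tmapE !tunitrE linearZr_LR linearZ.
Qed.

Lemma counitr_Delta h : counitr (Delta h) = h.
Proof. exact: comul1r. Qed.

Lemma counitr_tmapl (S : {linear H -> H}) x : counitr ((S \oxm I) x) = S (counitr x).
Proof.
by rewrite /=; expand_tensor x; rewrite !tmapE !tunitrE linearZ.
Qed.

(** The counit axiom inside the second factor; it is what allows a colinear map to be rebuilt from
    its counit component [counitr \o f]. *)
Lemma tmap_counitr_Delta :
  (counitr \oxm I) \o tassoc_inv \o (I \oxm Delta) =1 idfun.
Proof.
apply: tens_ext => g h; rewrite /= tmapE /= -[in RHS](comul1l (coalgebra_of B) h) /=.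
expand_tensor (Delta h).
by rewrite tassoc_invE !tmapE /= tmapE tunitrE tunitlE linearZl_LR linearZr_LR.
Qed.

Local Notation endo := {linear (H \ox H)%type -> (H \ox H)%type}.

(** * Left linear and right colinear endomorphisms of H ⊗ H *)

Section Linearity.
Implicit Types f g : endo.

(** Stronger than almost left linearity: [x] is any tensor, not just some 1 ⊗ h, so that the
    property is stable under composites and inverses. *)
Definition left_linear f : Prop :=
  forall a (x : H \ox H), f (actl (a \ox x)) = actl (a \ox f x).

Lemma left_linear_comp f g : left_linear f -> left_linear g -> left_linear (f \o g).
Proof. by move=> Lf Lg a x; rewrite /= Lg Lf. Qed.

Lemma left_linear_inv f g : cancel f g -> cancel g f -> left_linear f -> left_linear g.
Proof. by move=> fK gK Lf a x; rewrite -{1}(gK x) -Lf fK. Qed.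

Lemma left_linear_almost f : left_linear f -> almost_left_linear B f.
Proof. by move=> Lf g h; rewrite actl_mul -Lf actlE amul1r. Qed.

Lemma left_linear_id f : left_linear f ->
  (forall h, f (eta 1 \ox h) = eta 1 \ox h) -> f =1 id.
Proof.
move=> Lf f1; apply: (@tens_ext _ _ _ _ f idfun) => g h /=.
by rewrite -[g in LHS](amul1r (algebra_of B)) -actlE Lf f1 actlE amul1r.
Qed.

Definition right_colinear f : Prop :=
  (I \oxm Delta) \o f =1 tassoc \o (f \oxm I) \o tassoc_inv \o (I \oxm Delta).

Lemma right_colinear_comp f g :
  right_colinear f -> right_colinear g -> right_colinear (f \o g).
Proof.
move=> Cf Cg x; have /= -> := Cf (g x); have /= -> := Cg x; rewrite tassocK.
by congr tassoc; set y := tassoc_inv _; expand_tensor y; rewrite !tmapE.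
Qed.

Lemma right_colinear_inv f g :
  cancel f g -> cancel g f -> right_colinear f -> right_colinear g.
Proof.
(* With [x] on the right written as [f (g x)], colinearity of [f] at [g x] produces f ⊗ H, which g ⊗
   H cancels. *)
move=> fK gK Cf x; rewrite /= -{2}(gK x); have /= -> := Cf (g x).
rewrite tassocK; set y := _ _ (g x); rewrite -[LHS]tassoc_invK; congr tassoc.
by set z := tassoc_inv _; expand_tensor z; rewrite !tmapE /= fK.
Qed.

(** Expand [f x] by [tmap_counitr_Delta], then let colinearity carry H ⊗ Δ through [f]. *)
Lemma right_colinearE f : right_colinear f ->
  f =1 ((counitr \o f) \oxm I) \o tassoc_inv \o (I \oxm Delta).
Proof.
move=> Cf x; rewrite -[LHS]tmap_counitr_Delta /=; have /= -> := Cf x.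
rewrite tassocK; set y := tassoc_inv _; expand_tensor y.
by rewrite !tmapE.
Qed.

Lemma right_colinear_id f : right_colinear f -> counitr \o f =1 counitr -> f =1 id.
Proof.
move=> Cf f1 x; rewrite right_colinearE // -[RHS]tmap_counitr_Delta /=.
set y := tassoc_inv _; expand_tensor y.
by rewrite !tmapE [X in X \ox _]f1.
Qed.

(** Fusing the two counit maps gives exactly the conclusion of [right_colinearE], so strong
    colinearity implies the almost version. *)
Lemma almost_right_colinearE f : almost_right_colinear B f <->
  f =1 ((counitr \o f) \oxm I) \o tassoc_inv \o (I \oxm Delta).
Proof.
suff E x : ((counitr \o f) \oxm I) x =
    (tunitr \oxm I) (((I \oxm eps) \oxm I) ((f \oxm I) x)).
  by split=> + x => /(_ x) /= ->; rewrite /= E.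
by expand_tensor x; rewrite !tmapE.
Qed.
End Linearity.

(** * The right twist and its comparison with the right Galois map *)

Definition rtwist (S : {linear H -> H}) : H \ox H -> H \ox H :=
  actl \o (I \oxm ((S \oxm I) \o Delta)).
HB.instance Definition _ S := GRing.Linear.on (rtwist S).

Lemma rgaloisE g h : right_galois B (g \ox h) = actl (g \ox Delta h).
Proof. by rewrite /right_galois /= tmapE. Qed.

Lemma rtwistE S g h : rtwist S (g \ox h) = actl (g \ox (S \oxm I) (Delta h)).
Proof. by rewrite /rtwist /= tmapE. Qed.

Lemma counitr_rgalois x : counitr (right_galois B x) = mu x.
Proof.
move: x; apply: (@tens_ext _ _ _ _ (counitr \o right_galois B) mu) => g h.
by rewrite /= rgaloisE [LHS]counitr_actl counitr_Delta.
Qed.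

Lemma counitr_rtwist S x : counitr (rtwist S x) = mu ((I \oxm S) x).
Proof.
move: x; apply: (@tens_ext _ _ _ _ (counitr \o rtwist S) (mu \o (I \oxm S))) => g h.
by rewrite /= rtwistE [LHS]counitr_actl counitr_tmapl counitr_Delta tmapE.
Qed.

Lemma rgalois_tmapl (S : {linear H -> H}) x :
  right_galois B ((S \oxm I) x) =
  (mu \oxm I) (tassoc_inv ((S \oxm I2) ((I \oxm Delta) x))).
Proof.
rewrite /right_galois /=; congr (_ (tassoc_inv _)).
by expand_tensor x; rewrite !tmapE.
Qed.

Lemma rgalois_left_linear : associative_mul B -> left_linear (right_galois B).
Proof.
move=> A a x /=; expand_tensor x.
by rewrite actlE !rgaloisE actlA.
Qed.

(** Serves to transfer antipode axioms along a pointwise equality of antipodes. *)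
Lemma eq_rtwist (S T : {linear H -> H}) : S =1 T -> rtwist S =1 rtwist T.
Proof.
move=> ST; apply: tens_ext => g h; rewrite [LHS]rtwistE [RHS]rtwistE; congr (actl (_ \ox _)).
by expand_tensor (Delta h); rewrite !tmapE ST.
Qed.

Lemma rtwist_left_linear S : associative_mul B -> left_linear (rtwist S).
Proof.
move=> A a x /=; expand_tensor x.
by rewrite actlE !rtwistE actlA.
Qed.

(** Both sides send g ⊗ h to g h1 ⊗ h2 ⊗ h3; coassociativity moves the second Δ from the right leg
    of Δ(h) to the left one. *)
Lemma rgalois_right_colinear :
  coassociative_comul B -> right_colinear (right_galois B).
Proof.
move=> C; apply: tens_ext => g h; rewrite /= rgaloisE tmapE /= actl_nat.
have /= <- := C h; expand_tensor (Delta h).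
by rewrite tassoc_invE !tmapE /= actl_tassoc rgaloisE.
Qed.

Lemma rtwist_right_colinear S :
  coassociative_comul B -> right_colinear (rtwist S).
Proof.
move=> C; apply: tens_ext => g h; rewrite /= rtwistE tmapE /= actl_nat.
(* [S] and [Delta] act on different legs; exchanging them exposes (H ⊗ Δ) Δ to coassociativity. *)
have -> : (I \oxm Delta) ((S \oxm I) (Delta h)) =
    (S \oxm I2) ((I \oxm Delta) (Delta h)).
  by expand_tensor (Delta h); rewrite !tmapE.
have /= <- := C h; expand_tensor (Delta h).
rewrite tassoc_invE !tmapE /= rtwistE -actl_tassoc; congr actl; congr (_ \ox _).
set y := Delta _; expand_tensor y.
by rewrite tassocE !tmapE tassocE.
Qed.

Lemma rtwist_almost_left_linear S : almost_left_linear B (rtwist S).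
Proof. by move=> g h; rewrite actl_mul /= !rtwistE actl1. Qed.

Lemma rtwist_almost_right_colinear S : almost_right_colinear B (rtwist S).
Proof.
apply/almost_right_colinearE.
apply: tens_ext => g h; rewrite [LHS]rtwistE /= tmapE /=.
expand_tensor (Delta h).
by rewrite tassoc_invE !tmapE actlE; congr (_ \ox _); rewrite [RHS]counitr_rtwist tmapE.
Qed.

(** Colinearity reduces [phi] to [counitr \o phi], and almost linearity pulls g out of the latter.
    The precomposed map is h ↦ 1 ⊗ h. *)
Lemma rtwist_unique (phi : endo) :
  almost_left_linear B phi -> almost_right_colinear B phi ->
  phi =1 rtwist (counitr \o phi \o ((eta \oxm I) \o tunitl_inv)).
Proof.
move=> lin /almost_right_colinearE colin.
apply: tens_ext => g h; rewrite colin [RHS]rtwistE /= tmapE /=.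
expand_tensor (Delta h).
rewrite tassoc_invE !tmapE /= actlE; congr (_ \ox _).
by rewrite lin actl_mul [LHS]counitr_actl tmapE.
Qed.

(** * Right antipode axioms as inversion of the right Galois map *)

Definition quasi_right_antipode (S : {linear H -> H}) : Prop :=
  mu \o (mu \oxm I) \o (I2 \oxm S) \o tassoc_inv \o (I \oxm Delta)
    =1 tunitr \o (I \oxm eps) /\
  mu \o (mu \oxm I) \o ((I \oxm S) \oxm I) \o tassoc_inv \o (I \oxm Delta)
    =1 tunitr \o (I \oxm eps).

Definition coquasi_right_antipode (S : {linear H -> H}) : Prop :=
  (mu \oxm I) \o tassoc_inv \o (S \oxm I2) \o (I \oxm Delta) \o Delta
    =1 (eta \oxm I) \o tunitl_inv /\
  (mu \oxm I) \o ((I \oxm S) \oxm I) \o tassoc_inv \o (I \oxm Delta) \o Delta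
    =1 (eta \oxm I) \o tunitl_inv.

Lemma quasi_right_antipodeE S : coassociative_comul B ->
  quasi_right_antipode S <->
    cancel (right_galois B) (rtwist S) /\ cancel (rtwist S) (right_galois B).
Proof.
move=> C.
(* [E1] reads (g h1) S(h2), and [E2] reads (g S(h1)) h2, as the counit component of a composite of
   Galois map and twist; a colinear composite is determined by that component. *)
have E1 x : mu ((mu \oxm I) ((I2 \oxm S) (tassoc_inv ((I \oxm Delta) x)))) =
    counitr (rtwist S (right_galois B x)).
  rewrite counitr_rtwist /right_galois /=; congr (mu _).
  by set y := tassoc_inv _; expand_tensor y; rewrite !tmapE.
have E2 x : mu ((mu \oxm I) (((I \oxm S) \oxm I) (tassoc_inv ((I \oxm Delta) x)))) =
    counitr (right_galois B (rtwist S x)).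
  rewrite counitr_rgalois; congr (mu _); move: x.
  apply: (@tens_ext _ _ _ _
    ((mu \oxm I) \o ((I \oxm S) \oxm I) \o tassoc_inv \o (I \oxm Delta)) (rtwist S)) => g h.
  by rewrite /= rtwistE tmapE actl_tmapl.
have Cb := rgalois_right_colinear C; have Ct := rtwist_right_colinear S C.
split=> [[A1 A2]|[K1 K2]].
  split; apply: (right_colinear_id (right_colinear_comp _ _)) => // x /=.
    by rewrite -[LHS]E1 -[RHS]A1.
  by rewrite -[LHS]E2 -[RHS]A2.
by split=> x; rewrite /= ?E1 ?E2 ?K1 ?K2.
Qed.

Lemma coquasi_right_antipodeE S : associative_mul B ->
  coquasi_right_antipode S <->
    cancel (right_galois B) (rtwist S) /\ cancel (rtwist S) (right_galois B).
Proof.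
move=> A.
have E0 h : (eta \oxm I) (tunitl_inv h) = eta 1 \ox h by rewrite tmapE.
(* On 1 ⊗ h the two composites give S(h1) h2 ⊗ h3 and h1 S(h2) ⊗ h3; left linearity extends the
   identity from these elements to all tensors. *)
have E1 h : (mu \oxm I) (tassoc_inv ((S \oxm I2) ((I \oxm Delta) (Delta h)))) =
    right_galois B (rtwist S (eta 1 \ox h)).
  by rewrite rtwistE actl1 rgalois_tmapl.
have E2 h : (mu \oxm I) (((I \oxm S) \oxm I) (tassoc_inv ((I \oxm Delta) (Delta h)))) =
    rtwist S (right_galois B (eta 1 \ox h)).
  by rewrite rgaloisE actl1; expand_tensor (Delta h); rewrite rtwistE tmapE actl_tmapl.
have Lb := rgalois_left_linear A; have Lt := rtwist_left_linear S A.
split=> [[A1 A2]|[K1 K2]].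
  split; apply: (left_linear_id (left_linear_comp _ _)) => // h /=.
    by rewrite -E2 -E0 [LHS]A2.
  by rewrite -E1 -E0 [LHS]A1.
by split=> x; rewrite /= ?E1 ?E2 ?K1 ?K2 E0.
Qed.

(** [P] stands for either almost-condition, so both parts of the theorem share the argument: an
    inverse with both almost properties is a twist by [rtwist_unique]. *)
Lemma rgalois_inverse_rtwist (P : endo -> Prop) :
  (forall S, P (rtwist S)) ->
  (forall phi : endo, cancel (right_galois B) phi -> cancel phi (right_galois B) -> P phi ->
     almost_left_linear B phi /\ almost_right_colinear B phi) ->
  has_inverse_that_is (right_galois B) P <->
  exists S, cancel (right_galois B) (rtwist S) /\ cancel (rtwist S) (right_galois B).
Proof.
move=> Ptwist Palmost; split=> [[phi [K1 K2 Pphi]]|[S [K1 K2]]]; last by exists (rtwist S).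
have [lin colin] := Palmost _ K1 K2 Pphi.
have E := rtwist_unique lin colin.
(* Unification with [E] supplies the antipode h ↦ (H ⊗ ε)(phi (1 ⊗ h)). *)
by eexists; split; [exact: eq_can K1 (frefl _) E | exact: eq_can K2 E (frefl _)].
Qed.

Lemma rgalois_almost_left_linear : coassociative_comul B ->
  has_inverse_that_is (right_galois B) (almost_left_linear B) <->
  exists S, quasi_right_antipode S.
Proof.
move=> C; rewrite rgalois_inverse_rtwist.
- by split=> -[S /(quasi_right_antipodeE S C)]; exists S.
- exact: rtwist_almost_left_linear.
(* Almost colinearity of the inverse is automatic: it inherits strong colinearity from the Galois
   map. *)
move=> phi K1 K2 lin; split=> //; apply/almost_right_colinearE/right_colinearE.
exact: right_colinear_inv K1 K2 (rgalois_right_colinear C).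
Qed.

Lemma rgalois_almost_right_colinear : associative_mul B ->
  has_inverse_that_is (right_galois B) (almost_right_colinear B) <->
  exists S, coquasi_right_antipode S.
Proof.
move=> A; rewrite rgalois_inverse_rtwist.
- by split=> -[S /(coquasi_right_antipodeE S A)]; exists S.
- exact: rtwist_almost_right_colinear.
(* Here almost linearity comes for free, inherited from the left linear Galois map. *)
move=> phi K1 K2 colin; split=> //; apply: left_linear_almost.
exact: left_linear_inv K1 K2 (rgalois_left_linear A).
Qed.
(** * The left Galois map *)

Local Notation counitl := (tunitl \o (eps \oxm I)).

Definition actr {W : lmodType k} : (W \ox H) \ox H -> W \ox H :=
  (idfun \oxm mu) \o tassoc.
HB.instance Definition _ W := GRing.Linear.on (@actr W).

Lemma actrE (W : lmodType k) (a : W) b g : actr ((a \ox b) \ox g) = a \ox mu (b \ox g).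
Proof. by rewrite /actr /= tassocE tmapE. Qed.

Lemma actr_nat (W W' : lmodType k) (f : {linear W -> W'}) g x :
  (f \oxm I) (actr (x \ox g)) = actr ((f \oxm I) x \ox g).
Proof. by expand_tensor x; rewrite actrE !tmapE actrE. Qed.

Lemma actr_tmapr (S : {linear H -> H}) g x :
  actr ((I \oxm S) x \ox g) = (I \oxm mu) ((I \oxm (S \oxm I)) (tassoc (x \ox g))).
Proof. by expand_tensor x; rewrite tassocE !tmapE actrE /= tmapE. Qed.

Lemma actr_tassoc_inv g (x : H \ox H) (b : H) :
  actr (tassoc_inv (b \ox x) \ox g) = tassoc_inv (b \ox actr (x \ox g)).
Proof. by expand_tensor x; rewrite tassoc_invE !actrE tassoc_invE. Qed.

Lemma actr_mul g x : x ** (eta 1 \ox g) = actr (x \ox g).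
Proof. by expand_tensor x; rewrite tensor_amulE actrE amul1r. Qed.

Lemma actr1 x : actr (x \ox eta 1) = x :> (H \ox H).
Proof. rewrite -actr_mul -tensor_aunitE; exact: tensor_amul1r. Qed.

Lemma actrA : associative_mul B -> forall g g' (x : H \ox H),
  actr (x \ox mu (g' \ox g)) = actr (actr (x \ox g') \ox g).
Proof.
by move=> A g g' x; expand_tensor x; rewrite !actrE amulA.
Qed.

Lemma counitl_actr g x : counitl (actr (x \ox g)) = mu (counitl x \ox g).
Proof.
rewrite /=; expand_tensor x.
by rewrite actrE !tmapE !tunitlE linearZl_LR linearZ.
Qed.

Lemma counitl_Delta h : counitl (Delta h) = h.
Proof. exact: comul1l. Qed.

Lemma counitl_tmapr (S : {linear H -> H}) x : counitl ((I \oxm S) x) = S (counitl x).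
Proof.
by rewrite /=; expand_tensor x; rewrite !tmapE !tunitlE linearZ.
Qed.

Lemma tmap_counitl_Delta :
  (I \oxm counitl) \o tassoc \o (Delta \oxm I) =1 idfun.
Proof.
apply: tens_ext => h g; rewrite /= tmapE /= -[in RHS](comul1r (coalgebra_of B) h) /=.
expand_tensor (Delta h).
by rewrite tassocE !tmapE /= tmapE tunitrE tunitlE linearZl_LR linearZr_LR.
Qed.

(** * Right linear and left colinear endomorphisms of H ⊗ H *)

Section Linearity.
Implicit Types f g : endo.

Definition right_linear f : Prop :=
  forall a (x : H \ox H), f (actr (x \ox a)) = actr (f x \ox a).

Lemma right_linear_comp f g : right_linear f -> right_linear g -> right_linear (f \o g).
Proof. by move=> Lf Lg a x; rewrite /= Lg Lf. Qed.

Lemma right_linear_inv f g : cancel f g -> cancel g f -> right_linear f -> right_linear g.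
Proof. by move=> fK gK Lf a x; rewrite -{1}(gK x) -Lf fK. Qed.

Lemma right_linear_almost f : right_linear f -> almost_right_linear B f.
Proof. by move=> Lf g h; rewrite actr_mul -Lf actrE amul1l. Qed.

Lemma right_linear_id f : right_linear f ->
  (forall h, f (h \ox eta 1) = h \ox eta 1) -> f =1 id.
Proof.
move=> Lf f1; apply: (@tens_ext _ _ _ _ f idfun) => h g /=.
by rewrite -[g in LHS](amul1l (algebra_of B)) -actrE Lf f1 actrE amul1l.
Qed.

Definition left_colinear f : Prop :=
  (Delta \oxm I) \o f =1 tassoc_inv \o (I \oxm f) \o tassoc \o (Delta \oxm I).

Lemma left_colinear_comp f g :
  left_colinear f -> left_colinear g -> left_colinear (f \o g).
Proof.
move=> Cf Cg x; have /= -> := Cf (g x); have /= -> := Cg x; rewrite tassoc_invK.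
by congr tassoc_inv; set y := tassoc _; expand_tensor y; rewrite !tmapE.
Qed.

Lemma left_colinear_inv f g :
  cancel f g -> cancel g f -> left_colinear f -> left_colinear g.
Proof.
move=> fK gK Cf x; rewrite /= -{2}(gK x); have /= -> := Cf (g x).
rewrite tassoc_invK; set y := _ _ (g x); rewrite -[LHS]tassocK; congr tassoc_inv.
by set z := tassoc _; expand_tensor z; rewrite !tmapE /= fK.
Qed.

Lemma left_colinearE f : left_colinear f ->
  f =1 (I \oxm (counitl \o f)) \o tassoc \o (Delta \oxm I).
Proof.
move=> Cf x; rewrite -[LHS]tmap_counitl_Delta /=; have /= -> := Cf x.
rewrite tassoc_invK; set y := tassoc _; expand_tensor y.
by rewrite !tmapE.
Qed.

Lemma left_colinear_id f : left_colinear f -> counitl \o f =1 counitl -> f =1 id.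
Proof.
move=> Cf f1 x; rewrite left_colinearE // -[RHS]tmap_counitl_Delta /=.
set y := tassoc _; expand_tensor y.
by rewrite !tmapE [X in _ \ox X]f1.
Qed.

Lemma almost_left_colinearE f : almost_left_colinear B f <->
  f =1 (I \oxm (counitl \o f)) \o tassoc \o (Delta \oxm I).
Proof.
suff E x : (I \oxm (counitl \o f)) x =
    (I \oxm tunitl) ((I \oxm (eps \oxm I)) ((I \oxm f) x)).
  by split=> + x => /(_ x) /= ->; rewrite /= E.
by expand_tensor x; rewrite !tmapE.
Qed.
End Linearity.

(** * The left twist and its comparison with the left Galois map *)

Definition ltwist (S : {linear H -> H}) : H \ox H -> H \ox H :=
  actr \o (((I \oxm S) \o Delta) \oxm I).
HB.instance Definition _ S := GRing.Linear.on (ltwist S).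

Lemma lgaloisE g h : left_galois B (g \ox h) = actr (Delta g \ox h).
Proof. by rewrite /left_galois /= tmapE. Qed.

Lemma ltwistE S g h : ltwist S (g \ox h) = actr ((I \oxm S) (Delta g) \ox h).
Proof. by rewrite /ltwist /= tmapE. Qed.

Lemma counitl_lgalois x : counitl (left_galois B x) = mu x.
Proof.
move: x; apply: (@tens_ext _ _ _ _ (counitl \o left_galois B) mu) => g h.
by rewrite /= lgaloisE [LHS]counitl_actr counitl_Delta.
Qed.

Lemma counitl_ltwist S x : counitl (ltwist S x) = mu ((S \oxm I) x).
Proof.
move: x; apply: (@tens_ext _ _ _ _ (counitl \o ltwist S) (mu \o (S \oxm I))) => g h.
by rewrite /= ltwistE [LHS]counitl_actr counitl_tmapr counitl_Delta tmapE.
Qed.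

Lemma lgalois_right_linear : associative_mul B -> right_linear (left_galois B).
Proof.
move=> A a x /=; expand_tensor x.
by rewrite actrE !lgaloisE actrA.
Qed.

Lemma ltwist_right_linear S : associative_mul B -> right_linear (ltwist S).
Proof.
move=> A a x /=; expand_tensor x.
by rewrite actrE !ltwistE actrA.
Qed.

(** The left-hand computations start from (Δ ⊗ H) Δ and so rewrite by coassociativity in the
    opposite direction. *)
Lemma coassoc_inv : coassociative_comul B -> forall h,
  (Delta \oxm I) (Delta h) = tassoc_inv ((I \oxm Delta) (Delta h)).
Proof. by move=> C h; have /= <- := C h; rewrite tassocK. Qed.

Lemma lgalois_left_colinear :
  coassociative_comul B -> left_colinear (left_galois B).
Proof.
move=> C; apply: tens_ext => g h; rewrite /= lgaloisE tmapE /= actr_nat.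
rewrite coassoc_inv //; expand_tensor (Delta g).
by rewrite tassocE !tmapE /= actr_tassoc_inv lgaloisE.
Qed.

Lemma ltwist_left_colinear S :
  coassociative_comul B -> left_colinear (ltwist S).
Proof.
move=> C; apply: tens_ext => g h; rewrite /= ltwistE tmapE /= actr_nat.
have -> : (Delta \oxm I) ((I \oxm S) (Delta g)) =
    (I2 \oxm S) ((Delta \oxm I) (Delta g)).
  by expand_tensor (Delta g); rewrite !tmapE.
rewrite coassoc_inv //; expand_tensor (Delta g).
rewrite tassocE !tmapE /= ltwistE -actr_tassoc_inv; congr actr; congr (_ \ox _).
set y := Delta _; expand_tensor y.
by rewrite tassoc_invE !tmapE tassoc_invE.
Qed.

Lemma ltwist_almost_right_linear S : almost_right_linear B (ltwist S).
Proof. by move=> g h; rewrite actr_mul /= !ltwistE actr1. Qed.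

Lemma ltwist_almost_left_colinear S : almost_left_colinear B (ltwist S).
Proof.
apply/almost_left_colinearE.
apply: tens_ext => g h; rewrite [LHS]ltwistE /= tmapE /=.
expand_tensor (Delta g).
by rewrite tassocE !tmapE actrE; congr (_ \ox _); rewrite [RHS]counitl_ltwist tmapE.
Qed.

(** Mirror image of [rtwist_unique]: the antipode is g ↦ (ε ⊗ H)(phi (g ⊗ 1)). *)
Lemma ltwist_unique (phi : endo) :
  almost_right_linear B phi -> almost_left_colinear B phi ->
  phi =1 ltwist (counitl \o phi \o ((I \oxm eta) \o tunitr_inv)).
Proof.
move=> lin /almost_left_colinearE colin.
apply: tens_ext => g h; rewrite colin [RHS]ltwistE /= tmapE /=.
expand_tensor (Delta g).
rewrite tassocE !tmapE /= actrE; congr (_ \ox _).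
by rewrite lin actr_mul [LHS]counitl_actr tmapE.
Qed.

(** * Left antipode axioms as inversion of the left Galois map *)

Definition quasi_left_antipode (S : {linear H -> H}) : Prop :=
  mu \o (I \oxm mu) \o (S \oxm I2) \o tassoc \o (Delta \oxm I)
    =1 tunitl \o (eps \oxm I) /\
  mu \o (I \oxm mu) \o (I \oxm (S \oxm I)) \o tassoc \o (Delta \oxm I)
    =1 tunitl \o (eps \oxm I).

Definition coquasi_left_antipode (S : {linear H -> H}) : Prop :=
  (I \oxm mu) \o tassoc \o (I2 \oxm S) \o (Delta \oxm I) \o Delta
    =1 (I \oxm eta) \o tunitr_inv /\
  (I \oxm mu) \o (I \oxm (S \oxm I)) \o tassoc \o (Delta \oxm I) \o Delta
    =1 (I \oxm eta) \o tunitr_inv.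

Lemma quasi_left_antipodeE S : coassociative_comul B ->
  quasi_left_antipode S <->
    cancel (left_galois B) (ltwist S) /\ cancel (ltwist S) (left_galois B).
Proof.
move=> C.
(* The axioms S(g1)(g2 h) and g1 (S(g2) h) are the left counit components of the two composites. *)
have E1 x : mu ((I \oxm mu) ((S \oxm I2) (tassoc ((Delta \oxm I) x)))) =
    counitl (ltwist S (left_galois B x)).
  rewrite counitl_ltwist /left_galois /=; congr (mu _).
  by set y := tassoc _; expand_tensor y; rewrite !tmapE.
have E2 x : mu ((I \oxm mu) ((I \oxm (S \oxm I)) (tassoc ((Delta \oxm I) x)))) =
    counitl (left_galois B (ltwist S x)).
  rewrite counitl_lgalois; congr (mu _); move: x.
  apply: (@tens_ext _ _ _ _
    ((I \oxm mu) \o (I \oxm (S \oxm I)) \o tassoc \o (Delta \oxm I)) (ltwist S)) => g h.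
  by rewrite /= ltwistE tmapE actr_tmapr.
have Cb := lgalois_left_colinear C; have Ct := ltwist_left_colinear S C.
split=> [[A1 A2]|[K1 K2]].
  split; apply: (left_colinear_id (left_colinear_comp _ _)) => // x /=.
    by rewrite -[LHS]E1 -[RHS]A1.
  by rewrite -[LHS]E2 -[RHS]A2.
by split=> x; rewrite /= ?E1 ?E2 ?K1 ?K2.
Qed.

Lemma coquasi_left_antipodeE S : associative_mul B ->
  coquasi_left_antipode S <->
    cancel (left_galois B) (ltwist S) /\ cancel (ltwist S) (left_galois B).
Proof.
move=> A.
have E0 h : (I \oxm eta) (tunitr_inv h) = h \ox eta 1 by rewrite tmapE.
(* On h ⊗ 1 the composites give h1 ⊗ h2 S(h3) and h1 ⊗ S(h2) h3; right linearity does the rest. *)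
have E1 h : (I \oxm mu) (tassoc ((I2 \oxm S) ((Delta \oxm I) (Delta h)))) =
    left_galois B (ltwist S (h \ox eta 1)).
  rewrite ltwistE actr1 /left_galois /=; congr (_ (tassoc _)).
  by expand_tensor (Delta h); rewrite !tmapE.
have E2 h : (I \oxm mu) ((I \oxm (S \oxm I)) (tassoc ((Delta \oxm I) (Delta h)))) =
    ltwist S (left_galois B (h \ox eta 1)).
  rewrite lgaloisE actr1; expand_tensor (Delta h).
  by rewrite ltwistE tmapE actr_tmapr.
have Lb := lgalois_right_linear A; have Lt := ltwist_right_linear S A.
split=> [[A1 A2]|[K1 K2]].
  split; apply: (right_linear_id (right_linear_comp _ _)) => // h /=.
    by rewrite -E2 -E0 [LHS]A2.
  by rewrite -E1 -E0 [LHS]A1.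
by split=> x; rewrite /= ?E1 ?E2 ?K1 ?K2 E0.
Qed.

Lemma lgalois_inverse_ltwist (P : endo -> Prop) :
  (forall S, P (ltwist S)) ->
  (forall phi : endo, cancel (left_galois B) phi -> cancel phi (left_galois B) -> P phi ->
     almost_right_linear B phi /\ almost_left_colinear B phi) ->
  has_inverse_that_is (left_galois B) P <->
  exists S, cancel (left_galois B) (ltwist S) /\ cancel (ltwist S) (left_galois B).
Proof.
move=> Ptwist Palmost; split=> [[phi [K1 K2 Pphi]]|[S [K1 K2]]]; last by exists (ltwist S).
have [lin colin] := Palmost _ K1 K2 Pphi.
have E := ltwist_unique lin colin.
by eexists; split; [exact: eq_can K1 (frefl _) E | exact: eq_can K2 E (frefl _)].
Qed.

Lemma lgalois_almost_right_linear : coassociative_comul B ->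
  has_inverse_that_is (left_galois B) (almost_right_linear B) <->
  exists S, quasi_left_antipode S.
Proof.
move=> C; rewrite lgalois_inverse_ltwist.
- by split=> -[S /(quasi_left_antipodeE S C)]; exists S.
- exact: ltwist_almost_right_linear.
move=> phi K1 K2 lin; split=> //; apply/almost_left_colinearE/left_colinearE.
exact: left_colinear_inv K1 K2 (lgalois_left_colinear C).
Qed.

Lemma lgalois_almost_left_colinear : associative_mul B ->
  has_inverse_that_is (left_galois B) (almost_left_colinear B) <->
  exists S, coquasi_left_antipode S.
Proof.
move=> A; rewrite lgalois_inverse_ltwist.
- by split=> -[S /(coquasi_left_antipodeE S A)]; exists S.
- exact: ltwist_almost_left_colinear.
move=> phi K1 K2 colin; split=> //; apply: right_linear_almost.
exact: right_linear_inv K1 K2 (lgalois_right_linear A).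
Qed.

(** * The two antipodes agree *)

(** The first right axiom evaluated at 1 ⊗ h. *)
Lemma quasi_right_antipode_convolution S : quasi_right_antipode S ->
  forall h, mu ((I \oxm S) (Delta h)) = eps h *: eta 1.
Proof.
move=> [A _] h; rewrite -tunitrE -[X in X \ox _]/(I _) -tmapE -[RHS]A /= tmapE /=.
congr (mu _); expand_tensor (Delta h).
by rewrite tassoc_invE !tmapE /= amul1l.
Qed.

Lemma quasi_antipode_eq S T : coassociative_comul B ->
  quasi_left_antipode T -> quasi_right_antipode S -> S =1 T.
Proof.
move=> C [A _] /quasi_right_antipode_convolution E g.
(* S(g) = ε(g1) S(g2), which the axiom for [T], read backwards at g1 ⊗ S(g2), turns into T(g1)(g2
   S(g3)). *)
rewrite -[g in LHS]counitl_Delta -counitl_tmapr -[LHS]A /=.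
have -> : tassoc ((Delta \oxm I) ((I \oxm S) (Delta g))) =
    (I \oxm (I \oxm S)) (tassoc ((Delta \oxm I) (Delta g))).
  expand_tensor (Delta g); rewrite !tmapE /=.
  by set y := Delta _; expand_tensor y; rewrite !tassocE tmapE /= tmapE.
(* Coassociativity groups g2 with S(g3), whose product collapses to a counit by [E], leaving
   T(g). *)
have /= -> := C g; rewrite -[g in RHS]counitr_Delta /=.
expand_tensor (Delta g).
by rewrite !tmapE /= E tunitrE linearZr_LR !linearZ amul1r.
Qed.

(** Apply H ⊗ ε to the first axiom S(h1) h2 ⊗ h3 = 1 ⊗ h. *)
Lemma coquasi_right_antipode_convolution S : coquasi_right_antipode S ->
  forall h, mu ((S \oxm I) (Delta h)) = eps h *: eta 1.
Proof.
move=> [A _] h; rewrite -counitr_rgalois rgalois_tmapl [in LHS]/=.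
by have /= -> := A h; rewrite !tmapE tunitrE.
Qed.

Lemma coquasi_antipode_eq S T : associative_mul B ->
  coquasi_left_antipode T -> coquasi_right_antipode S -> S =1 T.
Proof.
move=> A [C _] /coquasi_right_antipode_convolution E h.
have assoc (y : H \ox H) c : mu ((S \oxm I) (actr (y \ox c))) = mu (mu ((S \oxm I) y) \ox c).
  by expand_tensor y; rewrite actrE !tmapE amulA.
(* Applying μ (S ⊗ H) to h1 ⊗ h2 T(h3) = h ⊗ 1 gives S(h1)(h2 T(h3)) = S(h); after [assoc] the
   factor S(h1) h2 collapses by [E], leaving T(h). *)
have /= := congr1 (mu \o (S \oxm I)) (C h).
rewrite !tmapE /= amul1r => <-; rewrite -[h in RHS]counitl_Delta /=.
expand_tensor (Delta h).
by rewrite !tmapE /= tunitlE linearZ /= [mu _]assoc E linearZl_LR linearZ /= amul1l.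
Qed.

(** Passing through the twist makes this immediate, since pointwise equal antipodes have pointwise
    equal twists. *)
Lemma eq_quasi_right_antipode (S T : {linear H -> H}) : coassociative_comul B ->
  S =1 T -> quasi_right_antipode S -> quasi_right_antipode T.
Proof.
move=> A /eq_rtwist E /(quasi_right_antipodeE S A)[K1 K2].
apply/(quasi_right_antipodeE T A).
by split; [exact: eq_can K1 (frefl _) E | exact: eq_can K2 E (frefl _)].
Qed.

Lemma eq_coquasi_right_antipode (S T : {linear H -> H}) : associative_mul B ->
  S =1 T -> coquasi_right_antipode S -> coquasi_right_antipode T.
Proof.
move=> A /eq_rtwist E /(coquasi_right_antipodeE S A)[K1 K2].
apply/(coquasi_right_antipodeE T A).
by split; [exact: eq_can K1 (frefl _) E | exact: eq_can K2 E (frefl _)].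
Qed.
End Galois.

(** * Assembly of the two equivalences *)

Theorem theorem2p5 (k : fieldType) (H : lmodType k) (B : nonassoc_bialgebra H) :
  (hopf_quasigroup B <->
     [/\ coassociative_comul B,
         has_inverse_that_is (right_galois B) (almost_left_linear B) &
         has_inverse_that_is (left_galois B) (almost_right_linear B)]) /\
  (hopf_coquasigroup B <->
     [/\ associative_mul B,
         has_inverse_that_is (right_galois B) (almost_right_colinear B) &
         has_inverse_that_is (left_galois B) (almost_left_colinear B)]).
Proof.
split; split.
- move=> [C [S [A1 A2 A3 A4]]]; split=> //.
    by apply/(rgalois_almost_left_linear C); exists S.
  by apply/(lgalois_almost_right_linear C); exists S.
- move=> [C /(rgalois_almost_left_linear C)[S SR] /(lgalois_almost_right_linear C)[T TL]].
  (* The two Galois maps yield a priori different antipodes; the left one [T] is kept, and the right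
     axioms are transferred to it from [S]. *)
  have [A3 A4] := eq_quasi_right_antipode C (quasi_antipode_eq C TL SR) SR.
  by split=> //; exists T; case: TL.
- move=> [A [S [A1 A2 A3 A4]]]; split=> //.
    by apply/(rgalois_almost_right_colinear A); exists S.
  by apply/(lgalois_almost_left_colinear A); exists S.
- move=> [A /(rgalois_almost_right_colinear A)[S SR] /(lgalois_almost_left_colinear A)[T TL]].
  have [A3 A4] := eq_coquasi_right_antipode A (coquasi_antipode_eq A TL SR) SR.
  by split=> //; exists T; case: TL.
Qed.
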